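(* Suppose that $f$ is smooth with $\nabla f$ Lipschitz continuous with constant $L$, and that $h$ is convex (possibly nonsmooth) and Lipschitz continuous with constant $L_h$. Let $\{X_k\}$ be generated by the ManPQN algorithm described in the context, where for all $k$ the operator $\mathcal{B}_k$ satisfies $\kappa_1\|V\|^2\le\|V\|_{\mathcal{B}_k}^2\le\kappa_2\|V\|^2$ for all $V\in {\rm T}_{X_k}\mathcal{M}$. Then every accumulation point $X^*$ of $\{X_k\}$ is a stationary point of the problem $\min_{X\in\mathcal{M}}F(X)$, i.e. $0\in {\rm grad} f(X^* )+{\rm Proj}_{{\rm T}_{X^*}\mathcal{M}}(\partial h(X^* ))$.
   Context: Let $\mathcal{M}={\rm St}(n,r)=\{X\in\mathbb{R}^{n\times r}: X^\top X=I_r\}$ with the Riemannian metric $\langle\xi,\zeta\rangle={\rm tr}(\xi^\top\zeta)$ and $\|\cdot\|$ the induced (Frobenius) norm. Its tangent space is ${\rm T}_X\mathcal{M}=\{V\in\mathbb{R}^{n\times r}: V^\top X+X^\top V=0\}$, and ${\rm Proj}_{{\rm T}_X\mathcal{M}}$ is the orthogonal projection $Z\mapsto Z-\frac12X(X^\top Z+Z^\top X)$. Let $f,h:\mathbb{R}^{n\times r}\to\mathbb{R}$ and $F=f+h$; $\nabla f$ is the Euclidean gradient, ${\rm grad} f(X)={\rm Proj}_{{\rm T}_X\mathcal{M}}\nabla f(X)$, and $\partial h$ is the convex subdifferential of $h$ on $\mathbb{R}^{n\times r}$. Let $\mathbf{R}$ be a retraction on $\mathcal{M}$: a smooth map from the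 tangent bundle to $\mathcal{M}$ whose restriction $\mathbf{R}_X$ to ${\rm T}_X\mathcal{M}$ satisfies $\mathbf{R}_X(0_X)=X$ and ${\rm D}\mathbf{R}_X(0_X)={\bf id}$. Constants: $\varrho=\sup_{X\in\mathcal{M}}\|\nabla f(X)\|$; for parameters $\delta>0$ and a positive integer $p$, with $\upsilon=(4L+4\varrho+5\delta)/\delta$, $$\kappa_1=\Big(\frac{\upsilon^{2p}-1}{\upsilon^2-1}\cdot\frac4\delta+\frac{\upsilon^{2p}}{\delta}\Big)^{-1},\qquad \kappa_2=\delta+\frac{4(L+\varrho+\delta)^2}{\delta}p.$$ ManPQN algorithm: parameters $\gamma,\sigma\in(0,1)$, integer $m>0$, initial point $X_0\in\mathcal{M}$. For $k=0,1,2,\dots$: given a symmetric positive definite linear operator $\mathcal{B}_k$ on ${\rm T}_{X_k}\mathcal{M}$, with $\|V\|_{\mathcal{B}_k}^2=\langle V,\mathcal{B}_k[V]\rangle$, let $$V_k=\arg\min_{V\in{\rm T}_{X_k}\mathcal{M}}\ \langle\nabla f(X_k),V\rangle+\tfrac12\|V\|_{\mathcal{B}_k}^2+h(X_k+V);$$ set $\alpha_k=\gamma^{N_k}$ where $N_k\ge0$ is the smallest integer such that $$F(\mathbf{R}_{X_k}(\alpha_kV_k))\le\max_{\max\{0,k-m\}\le j\le k}F(X_j)-\tfrac12\sigma\alpha_k\|V_k\|_{\mathcal{B}_k}^2;$$ set $X_{k+1}=\mathbf{R}_{X_k}(\alpha_kV_k)$. *)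

(* Defs.v *)
From mathcomp Require Import all_boot all_order all_algebra.
From mathcomp Require Import all_classical all_reals all_analysis.

Set Implicit Arguments.
Unset Strict Implicit.
Unset Printing Implicit Defensive.

Import Order.TTheory GRing.Theory Num.Theory.
Import numFieldNormedType.Exports.

Local Open Scope classical_set_scope.
Local Open Scope ring_scope.

(* The library norm on 'M[R]_(n, r) is the max norm; it only serves to define
   limits and derivatives. All quantitative statements use the trace inner
   product and the Frobenius norm. *)
Definition frob_dot (R : realType) (n r : nat) (U V : 'M[R]_(n, r)) : R :=
  \tr (U^T *m V).

Definition frob_norm (R : realType) (n r : nat) (V : 'M[R]_(n, r)) : R :=
  Num.sqrt (frob_dot V V).

Definition stiefel (R : realType) (n r : nat) : set 'M[R]_(n, r) :=
  [set X | X^T *m X = 1%:M].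
Arguments stiefel : clear implicits.

Definition tangent (R : realType) (n r : nat) (X : 'M[R]_(n, r)) :
    set 'M[R]_(n, r) :=
  [set V | V^T *m X + X^T *m V = 0].

Definition tangent_proj (R : realType) (n r : nat) (X Z : 'M[R]_(n, r)) :
    'M[R]_(n, r) :=
  Z - 2^-1 *: (X *m (X^T *m Z + Z^T *m X)).

Definition gradient (R : realType) (n r : nat) (f : 'M[R]_(n, r) -> R)
    (X : 'M[R]_(n, r)) : 'M[R]_(n, r) :=
  \matrix_(i < n, j < r) 'D_(delta_mx i j) f X.

Definition riem_gradient (R : realType) (n r : nat) (f : 'M[R]_(n, r) -> R)
    (X : 'M[R]_(n, r)) : 'M[R]_(n, r) :=
  tangent_proj X (gradient f X).

Definition subdifferential (R : realType) (n r : nat) (h : 'M[R]_(n, r) -> R)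
    (X : 'M[R]_(n, r)) : set 'M[R]_(n, r) :=
  [set G | forall Y, h X + frob_dot G (Y - X) <= h Y].

Definition stationary (R : realType) (n r : nat) (f h : 'M[R]_(n, r) -> R)
    (X : 'M[R]_(n, r)) : Prop :=
  stiefel R n r X /\
  [set riem_gradient f X + W | W in tangent_proj X @` subdifferential h X] 0.

(* C^k on an open set U; since the iterated 'D_v range over all directions,
   this is the usual notion in finite dimension. *)
Fixpoint Ck_on (R : realType) (V W : normedModType R) (k : nat) (U : set V)
    (g : V -> W) : Prop :=
  match k with
  | 0 => forall x, U x -> {for x, continuous g}
  | k'.+1 => (forall x, U x -> differentiable g x) /\
             (forall v, Ck_on k' U (fun x => 'D_v g x))
  end.

(* A map on a subset A (here an embedded submanifold) of a normed space is
   smooth when it locally extends to a C^infinity map on an open set of the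
   ambient space. *)
Definition smooth_on (R : realType) (V W : normedModType R) (A : set V)
    (g : V -> W) : Prop :=
  forall x, A x -> exists (U : set V) (G : V -> W),
    [/\ open U, U x, forall k, Ck_on k U G & forall y, A y -> U y -> G y = g y].

Definition tangent_bundle (R : realType) (n r : nat) :
    set ('M[R]_(n, r) * 'M[R]_(n, r)) :=
  [set XV | stiefel R n r XV.1 /\ tangent XV.1 XV.2].
Arguments tangent_bundle : clear implicits.

(* Values of Rt outside the tangent bundle are irrelevant. The differential of
   Rt X : T_X M -> M at 0_X is evaluated along the curves t |-> t V. *)
Record retraction (R : realType) (n r : nat)
    (Rt : 'M[R]_(n, r) -> 'M[R]_(n, r) -> 'M[R]_(n, r)) : Prop := Retraction {
  retraction_stiefel : forall X V, stiefel R n r X -> tangent X V ->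
    stiefel R n r (Rt X V);
  retraction_smooth : smooth_on (tangent_bundle R n r) (fun XV => Rt XV.1 XV.2);
  retraction0 : forall X, stiefel R n r X -> Rt X 0 = X;
  retraction_diff0 : forall X V, stiefel R n r X -> tangent X V ->
    is_derive (0 : R) (1 : R) (fun t : R => Rt X (t *: V)) V
}.

(* A linear operator on T_X M is encoded as a function on the ambient space of
   which only the restriction to T_X M matters. *)
Record spd_on_tangent (R : realType) (n r : nat) (X : 'M[R]_(n, r))
    (B : 'M[R]_(n, r) -> 'M[R]_(n, r)) : Prop := SpdOnTangent {
  spd_stable : forall V, tangent X V -> tangent X (B V);
  spd_linear : forall (a : R) U V, tangent X U -> tangent X V ->
    B (a *: U + V) = a *: B U + B V;
  spd_sym : forall U V, tangent X U -> tangent X V ->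
    frob_dot U (B V) = frob_dot (B U) V;
  spd_pos : forall V, tangent X V -> V != 0 -> 0 < frob_dot V (B V)
}.

Definition sqnorm_op (R : realType) (n r : nat)
    (B : 'M[R]_(n, r) -> 'M[R]_(n, r)) (V : 'M[R]_(n, r)) : R :=
  frob_dot V (B V).

Definition frob_lipschitz (R : realType) (n r : nat) (L : R)
    (g : 'M[R]_(n, r) -> 'M[R]_(n, r)) : Prop :=
  0 <= L /\ forall X Y, frob_norm (g X - g Y) <= L * frob_norm (X - Y).

Definition frob_lipschitz_fun (R : realType) (n r : nat) (L : R)
    (g : 'M[R]_(n, r) -> R) : Prop :=
  0 <= L /\ forall X Y, `|g X - g Y| <= L * frob_norm (X - Y).

Definition varrho (R : realType) (n r : nat) (f : 'M[R]_(n, r) -> R) : R :=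
  sup [set frob_norm (gradient f X) | X in stiefel R n r].

Definition upsilon (R : realType) (L rho delta : R) : R :=
  (4 * L + 4 * rho + 5 * delta) / delta.

Definition kappa1 (R : realType) (L rho delta : R) (p : nat) : R :=
  let u := upsilon L rho delta in
  ((u ^+ (2 * p) - 1) / (u ^+ 2 - 1) * (4 / delta) + u ^+ (2 * p) / delta)^-1.

Definition kappa2 (R : realType) (L rho delta : R) (p : nat) : R :=
  delta + 4 * (L + rho + delta) ^+ 2 / delta * p%:R.

Definition sub_objective (R : realType) (n r : nat) (f h : 'M[R]_(n, r) -> R)
    (B : 'M[R]_(n, r) -> 'M[R]_(n, r)) (X V : 'M[R]_(n, r)) : R :=
  frob_dot (gradient f X) V + 2^-1 * sqnorm_op B V + h (X + V).

(* k - m is truncated, i.e. max {0, k - m}; the default value F (X k) of the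
   iterated maximum is one of its terms. *)
Definition linesearch_ok (R : realType) (n r : nat) (F : 'M[R]_(n, r) -> R)
    (Rt : 'M[R]_(n, r) -> 'M[R]_(n, r) -> 'M[R]_(n, r)) (sigma : R) (m : nat)
    (X : nat -> 'M[R]_(n, r)) (k : nat) (B : 'M[R]_(n, r) -> 'M[R]_(n, r))
    (V : 'M[R]_(n, r)) (alpha : R) : Prop :=
  F (Rt (X k) (alpha *: V)) <=
    \big[Num.max/F (X k)]_(k - m <= j < k.+1) F (X j)
    - 2^-1 * sigma * alpha * sqnorm_op B V.

Record manPQN (R : realType) (n r : nat) (f h : 'M[R]_(n, r) -> R)
    (Rt : 'M[R]_(n, r) -> 'M[R]_(n, r) -> 'M[R]_(n, r))
    (gamma sigma : R) (m : nat)
    (B : nat -> 'M[R]_(n, r) -> 'M[R]_(n, r))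
    (X V : nat -> 'M[R]_(n, r)) (N : nat -> nat) : Prop := ManPQN {
  manPQN_init : stiefel R n r (X 0%N);
  manPQN_spd : forall k, spd_on_tangent (X k) (B k);
  manPQN_tangent : forall k, tangent (X k) (V k);
  manPQN_argmin : forall k U, tangent (X k) U ->
    sub_objective f h (B k) (X k) (V k) <= sub_objective f h (B k) (X k) U;
  manPQN_linesearch : forall k,
    linesearch_ok (f \+ h) Rt sigma m X k (B k) (V k) (gamma ^+ N k);
  manPQN_smallest : forall k i, (i < N k)%N ->
    ~ linesearch_ok (f \+ h) Rt sigma m X k (B k) (V k) (gamma ^+ i);
  manPQN_step : forall k, X k.+1 = Rt (X k) (gamma ^+ N k *: V k)
}.

(* Main.v *)
Require Import Defs.
From mathcomp Require Import all_boot all_order all_algebra.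
From mathcomp Require Import all_classical all_reals all_analysis.
From mathcomp Require Import ring lra.
Import Order.TTheory GRing.Theory Num.Theory.
Import numFieldNormedType.Exports.
Local Open Scope classical_set_scope.
Local Open Scope ring_scope.

(** Why accumulation points are stationary.

    The minimizer V_k of the model satisfies, by convexity of h,
    <nabla f(X_k), V_k> + h(X_k + V_k) - h(X_k) <= - ||V_k||_B^2
    ([sub_argmin_decrease]), so V_k is a descent direction for the linearized
    objective. Compactness of the Stiefel manifold makes the first-order
    expansion R_X(V) = X + V + o(||V||) uniform in X ([retraction_uniform]);
    combined with the Taylor bound for f it turns the model decrease into a
    decrease of F along the retraction, for every step whose length t ||V|| is
    below a threshold depending only on a lower bound for ||V||.

    The acceptance test bounds F(X_{k+1}) by the maximum of F over a window
    minus a multiple of d_k^2, where d_k = alpha_k ||V_k||, while F increases by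
    at most a multiple of d_k in one step. Since F is bounded below on the
    manifold, these two facts about real sequences force d_k to tend to 0
    ([nonmonotone_descent]). If ||V_k|| stayed above e
    for a late k, then alpha_k < 1, and the rejected trial step alpha_k / gamma
    would still be short enough to be accepted. Hence V_k tends to 0
    ([manPQN_steps_vanish]).

    Comparing V_k with the projection of a fixed tangent vector U onto the
    tangent space at X_k and going to the accumulation point X gives
    <nabla f(X), U> + (kappa_2 / 2) ||U||^2 + h(X + U) - h(X) >= 0 for all
    tangent U. Replacing U by t U and letting t tend to 0 removes the quadratic
    term ([variational_of_quadratic]). What remains says that the linear form
    - <nabla f(X), U> on the tangent space lies below the convex function
    h(X + U) - h(X); a Hahn-Banach extension to the whole matrix space
    ([convex_extension]) is a subgradient W of h at X such that
    nabla f(X) + W is normal to the manifold ([normal_subgradient]). *)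

Set Implicit Arguments.
Unset Strict Implicit.
Unset Printing Implicit Defensive.

(** * The Frobenius inner product *)

Lemma frob_dotE (R : realType) (n r : nat) (U V : 'M[R]_(n, r)) :
  frob_dot U V = \sum_(ij : 'I_n * 'I_r) U ij.1 ij.2 * V ij.1 ij.2.
Proof.
rewrite /frob_dot /mxtrace (eq_bigr (fun j => \sum_i U i j * V i j)); last first.
  by move=> j _; rewrite mxE; apply: eq_bigr => i _; rewrite mxE.
by rewrite exchange_big pair_bigA.
Qed.

Lemma frob_dotC (R : realType) (n r : nat) (U V : 'M[R]_(n, r)) :
  frob_dot U V = frob_dot V U.
Proof. by rewrite !frob_dotE; apply: eq_bigr => ij _; rewrite mulrC. Qed.

Lemma frob_dotDr (R : realType) (n r : nat) (U V W : 'M[R]_(n, r)) :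
  frob_dot U (V + W) = frob_dot U V + frob_dot U W.
Proof. by rewrite /frob_dot mulmxDr mxtraceD. Qed.

Lemma frob_dotZr (R : realType) (n r : nat) (a : R) (U V : 'M[R]_(n, r)) :
  frob_dot U (a *: V) = a * frob_dot U V.
Proof. by rewrite /frob_dot -scalemxAr mxtraceZ. Qed.

Lemma frob_dotDl (R : realType) (n r : nat) (U V W : 'M[R]_(n, r)) :
  frob_dot (U + V) W = frob_dot U W + frob_dot V W.
Proof. by rewrite frob_dotC frob_dotDr !(frob_dotC W). Qed.

Lemma frob_dotZl (R : realType) (n r : nat) (a : R) (U V : 'M[R]_(n, r)) :
  frob_dot (a *: U) V = a * frob_dot U V.
Proof. by rewrite frob_dotC frob_dotZr frob_dotC. Qed.

Lemma frob_dotNr (R : realType) (n r : nat) (U V : 'M[R]_(n, r)) :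
  frob_dot U (- V) = - frob_dot U V.
Proof. by rewrite -scaleN1r frob_dotZr mulN1r. Qed.

Lemma frob_dotNl (R : realType) (n r : nat) (U V : 'M[R]_(n, r)) :
  frob_dot (- U) V = - frob_dot U V.
Proof. by rewrite frob_dotC frob_dotNr frob_dotC. Qed.

Lemma frob_dot0r (R : realType) (n r : nat) (U : 'M[R]_(n, r)) :
  frob_dot U 0 = 0.
Proof. by rewrite -(scale0r 0) frob_dotZr mul0r. Qed.

Definition frob_dot_lin :=
  (frob_dotDl, frob_dotDr, frob_dotNl, frob_dotNr, frob_dotZl, frob_dotZr).

Lemma frob_dot_ge0 (R : realType) (n r : nat) (U : 'M[R]_(n, r)) :
  0 <= frob_dot U U.
Proof. by rewrite frob_dotE sumr_ge0// => ij _; rewrite -expr2 sqr_ge0. Qed.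

Lemma frob_norm_ge0 (R : realType) (n r : nat) (U : 'M[R]_(n, r)) :
  0 <= frob_norm U.
Proof. exact: sqrtr_ge0. Qed.

Lemma sqr_frob_norm (R : realType) (n r : nat) (U : 'M[R]_(n, r)) :
  frob_norm U ^+ 2 = frob_dot U U.
Proof. by rewrite sqr_sqrtr// frob_dot_ge0. Qed.

Lemma ler_coord_frob_norm (R : realType) (n r : nat) (U : 'M[R]_(n, r)) i j :
  `|U i j| <= frob_norm U.
Proof.
rewrite -sqrtr_sqr ler_sqrt ?frob_dot_ge0// frob_dotE (bigD1 (i, j))//= expr2.
by rewrite lerDl sumr_ge0// => ij _; rewrite -expr2 sqr_ge0.
Qed.

Lemma frob_norm_eq0 (R : realType) (n r : nat) (U : 'M[R]_(n, r)) :
  frob_norm U = 0 -> U = 0.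
Proof.
move=> U0; apply/matrixP => i j; rewrite mxE; apply/eqP.
by rewrite -normr_le0 -U0 ler_coord_frob_norm.
Qed.

Lemma frob_normZ (R : realType) (n r : nat) (a : R) (U : 'M[R]_(n, r)) :
  frob_norm (a *: U) = `|a| * frob_norm U.
Proof.
by rewrite /frob_norm !frob_dot_lin mulrA -expr2 sqrtrM ?sqr_ge0// sqrtr_sqr.
Qed.

Lemma frob_normN (R : realType) (n r : nat) (U : 'M[R]_(n, r)) :
  frob_norm (- U) = frob_norm U.
Proof. by rewrite -scaleN1r frob_normZ normrN1 mul1r. Qed.

Lemma frob_cauchy_schwarz (R : realType) (n r : nat) (U V : 'M[R]_(n, r)) :
  `|frob_dot U V| <= frob_norm U * frob_norm V.
Proof.
have half (A B : 'M[R]_(n, r)) : frob_dot A B <= frob_norm A * frob_norm B.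
  have [A0|A0] := eqVneq (frob_norm A) 0.
    by rewrite A0 mul0r (frob_norm_eq0 A0) frob_dotC frob_dot0r.
  have [B0|B0] := eqVneq (frob_norm B) 0.
    by rewrite B0 mulr0 (frob_norm_eq0 B0) frob_dot0r.
  have AB : 0 < frob_norm A * frob_norm B.
    by rewrite mulr_gt0// lt_neqAle eq_sym ?A0 ?B0 frob_norm_ge0.
  have := frob_dot_ge0 (frob_norm B *: A - frob_norm A *: B).
  rewrite !frob_dot_lin (frob_dotC B A) -!sqr_frob_norm.
  set a := frob_norm A in AB *; set b := frob_norm B in AB *.
  set d := frob_dot A B => H; rewrite -(ler_pM2l AB); nra.
by rewrite ler_norml half andbT lerNl -frob_dotNl -(frob_normN U) half.
Qed.

Lemma ler_frob_normD (R : realType) (n r : nat) (U V : 'M[R]_(n, r)) :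
  frob_norm (U + V) <= frob_norm U + frob_norm V.
Proof.
rewrite -(@ler_pXn2r _ 2)// ?nnegrE ?addr_ge0 ?frob_norm_ge0//.
have := le_trans (ler_norm _) (frob_cauchy_schwarz U V).
rewrite sqr_frob_norm !frob_dot_lin sqrrD !sqr_frob_norm (frob_dotC V U); lra.
Qed.

Lemma ler_frob_norm_sum (R : realType) (n r : nat) (U : 'M[R]_(n, r)) :
  frob_norm U <= \sum_(ij : 'I_n * 'I_r) `|U ij.1 ij.2|.
Proof.
have S0 : 0 <= \sum_(ij : 'I_n * 'I_r) `|U ij.1 ij.2| by rewrite sumr_ge0.
rewrite -(@ler_pXn2r _ 2)// ?nnegrE ?frob_norm_ge0// sqr_frob_norm frob_dotE.
rewrite expr2 mulr_suml ler_sum// => ij _.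
rewrite (le_trans (ler_norm _))// normrM ler_wpM2l// (bigD1 ij)//= lerDl.
by rewrite sumr_ge0.
Qed.

(** * The tangent spaces of the Stiefel manifold *)

Lemma tangent0 (R : realType) (n r : nat) (X : 'M[R]_(n, r)) : tangent X 0.
Proof. by rewrite /tangent /= trmx0 mul0mx mulmx0 addr0. Qed.

Lemma tangentZ (R : realType) (n r : nat) (X V : 'M[R]_(n, r)) (a : R) :
  tangent X V -> tangent X (a *: V).
Proof.
by rewrite /tangent /= linearZ /= -scalemxAl -scalemxAr -scalerDr => ->; rewrite scaler0.
Qed.

Lemma tangent_proj_tangent (R : realType) (n r : nat) (X Z : 'M[R]_(n, r)) :
  stiefel R n r X -> tangent X (tangent_proj X Z).
Proof.
rewrite /stiefel /tangent /tangent_proj /= => XX.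
rewrite linearB /= linearZ /= trmx_mul linearD /= !trmx_mul !trmxK.
rewrite mulmxBl mulmxBr -scalemxAl -scalemxAr -mulmxA XX mulmx1 mulmxA XX mul1mx.
rewrite [LHS]addrACA -opprD (addrC (X^T *m Z)) -scalerDl.
by rewrite (_ : 2^-1 + 2^-1 = 1 :> R) ?scale1r ?subrr//; lra.
Qed.

Lemma tangent_proj_id (R : realType) (n r : nat) (X V : 'M[R]_(n, r)) :
  tangent X V -> tangent_proj X V = V.
Proof.
by rewrite /tangent /tangent_proj /= addrC => ->; rewrite mulmx0 scaler0 subr0.
Qed.

Lemma tangent_projD (R : realType) (n r : nat) (X Z W : 'M[R]_(n, r)) :
  tangent_proj X (Z + W) = tangent_proj X Z + tangent_proj X W.
Proof.
rewrite /tangent_proj [(Z + W)^T]linearD /= (mulmxDr X^T) (mulmxDl Z^T).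
rewrite [X^T *m Z + _ + _]addrACA [X *m (_ + _ + _)]mulmxDr.
by rewrite scalerDr opprD [LHS]addrACA.
Qed.

Lemma tangent_projZ (R : realType) (n r : nat) (X Z : 'M[R]_(n, r)) (a : R) :
  tangent_proj X (a *: Z) = a *: tangent_proj X Z.
Proof.
rewrite /tangent_proj [(a *: Z)^T]linearZ /= -scalemxAl -!scalemxAr -scalerDr -scalemxAr.
by rewrite scalerBr !scalerA mulrC.
Qed.

Lemma tangent_proj_sym (R : realType) (n r : nat) (X Z W : 'M[R]_(n, r)) :
  frob_dot (tangent_proj X Z) W = frob_dot Z (tangent_proj X W).
Proof.
rewrite /tangent_proj !frob_dot_lin; congr (_ - _ * _).
rewrite /frob_dot trmx_mul linearD /= !trmx_mul !trmxK.
have swap : \tr (X^T *m Z *m (X^T *m W)) = \tr (Z^T *m X *m (W^T *m X)).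
  by rewrite -mxtrace_tr !trmx_mul !trmxK mxtrace_mulC.
rewrite mulmxA mulmxDr !mulmxDl !mxtraceD.
by rewrite -!(mulmxA _ X^T) swap.
Qed.

(** * Limits of matrices and compactness of the Stiefel manifold *)

(** The neighbourhoods of a matrix are those of the product topology on its
    entries, so convergence can be tested entrywise; the finitely many entries
    are what lets the filter conditions be intersected. *)
Lemma cvg_mx (R : realType) (n r : nat) (T : Type) (F : set_system T)
    {FF : Filter F} (A : T -> 'M[R]_(n, r)) (l : 'M[R]_(n, r)) :
  (forall i j, A x i j @[x --> F] --> l i j) -> A @ F --> l.
Proof.
move=> Al S [P lP PS].
apply: (@filterS _ F _ [set x | forall i j, P i j (A x i j)]) => [x Px|].
  exact: PS.
have H i : \forall x \near F, forall j, P i j (A x i j).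
  by apply: (@filter_forall _ _ (fun j x => P i j (A x i j))) => j; exact: Al.
exact: (@filter_forall _ _ (fun i x => forall j, P i j (A x i j))) H.
Qed.

Lemma cvg_coord (R : realType) (n r : nat) (T : Type) (F : set_system T)
    {FF : Filter F} (A : T -> 'M[R]_(n, r)) (l : 'M[R]_(n, r)) i j :
  A @ F --> l -> A x i j @[x --> F] --> l i j.
Proof. by move=> Al; exact: (cvg_comp _ _ Al (@coord_continuous R n r i j l)). Qed.

Lemma cvg_trmx (R : realType) (n r : nat) (T : Type) (F : set_system T)
    {FF : Filter F} (A : T -> 'M[R]_(n, r)) (l : 'M[R]_(n, r)) :
  A @ F --> l -> (A x)^T @[x --> F] --> l^T.
Proof.
move=> Al; apply: cvg_mx => i j; rewrite mxE.
by under eq_fun do rewrite mxE; exact: cvg_coord.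
Qed.

Lemma cvg_mulmx (R : realType) (n r q : nat) (T : Type) (F : set_system T)
    {FF : Filter F} (A : T -> 'M[R]_(n, r)) (C : T -> 'M[R]_(r, q))
    (a : 'M[R]_(n, r)) (c : 'M[R]_(r, q)) :
  A @ F --> a -> C @ F --> c -> A x *m C x @[x --> F] --> a *m c.
Proof.
move=> Aa Cc; apply: cvg_mx => i j; rewrite mxE.
under eq_fun do rewrite mxE.
apply: cvg_big => [|k _]; first exact: add_continuous.
by apply: cvgM; exact: cvg_coord.
Qed.

Lemma cvg_frob_dot (R : realType) (n r : nat) (T : Type) (F : set_system T)
    {FF : Filter F} (A C : T -> 'M[R]_(n, r)) (a c : 'M[R]_(n, r)) :
  A @ F --> a -> C @ F --> c -> frob_dot (A x) (C x) @[x --> F] --> frob_dot a c.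
Proof.
move=> Aa Cc; apply: cvg_big => [|i _]; first exact: add_continuous.
by apply: cvg_coord; apply: cvg_mulmx Cc; exact: cvg_trmx.
Qed.

Lemma cvg_tangent_proj (R : realType) (n r : nat) (T : Type) (F : set_system T)
    {FF : Filter F} (A : T -> 'M[R]_(n, r)) (a U : 'M[R]_(n, r)) :
  A @ F --> a -> tangent_proj (A x) U @[x --> F] --> tangent_proj a U.
Proof.
move=> Aa; apply: cvgB; first exact: cvg_cst.
apply: cvgZ; first exact: cvg_cst.
apply: cvg_mulmx => //; apply: cvgD.
  by apply: cvg_mulmx; [exact: cvg_trmx|exact: cvg_cst].
by apply: cvg_mulmx; [exact: cvg_cst|exact: Aa].
Qed.

Lemma cvg_frob_norm_sub (R : realType) (n r : nat) (T : Type) (F : set_system T)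
    {FF : Filter F} (A : T -> 'M[R]_(n, r)) (a : 'M[R]_(n, r)) :
  A @ F --> a -> frob_norm (A x - a) @[x --> F] --> 0.
Proof.
move=> Aa; rewrite -(sqrtr0 R).
have Aa0 : ((A x - a) @[x --> F] --> (0 : 'M[R]_(n, r))).
  by rewrite -(subrr a); apply: cvgB => //; exact: cvg_cst.
apply: (@continuous_cvg _ _ _ _ FF
  (fun x => frob_dot (A x - a) (A x - a)) (@Num.sqrt R) 0).
  exact: sqrt_continuous.
rewrite -[X in _ --> X](frob_dot0r (0 : 'M[R]_(n, r))).
exact: (cvg_frob_dot Aa0 Aa0).
Qed.

(** Continuity refers to the max norm whereas Lipschitz bounds are stated in the
    Frobenius norm; the two are reconciled by [cvg_frob_norm_sub]. *)
Lemma frob_lipschitz_fun_continuous (R : realType) (n r : nat) (L : R)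
    (g : 'M[R]_(n, r) -> R) :
  frob_lipschitz_fun L g -> continuous g.
Proof.
move=> [_ gL] X; change (g @ nbhs (X : 'M[R]_(n, r)) --> g X).
have XL : (fun Y => L * frob_norm (Y - X)) @ nbhs X --> (0 : R).
  rewrite -(mulr0 L); apply: cvgM; first exact: cvg_cst.
  by apply: cvg_frob_norm_sub; exact: cvg_id.
apply/cvgrPdist_le => e e0.
move/cvgrPdist_le : XL => /(_ _ e0); apply: filterS => Y.
rewrite sub0r normrN => /(le_trans (ler_norm _)); apply: le_trans.
by rewrite distrC gL.
Qed.

Lemma frob_lipschitz_continuous (R : realType) (n r : nat) (L : R)
    (g : 'M[R]_(n, r) -> 'M[R]_(n, r)) :
  frob_lipschitz L g -> continuous g.
Proof.
move=> [L0 gL] X; change (g @ nbhs (X : 'M[R]_(n, r)) --> g X).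
apply: cvg_mx => i j.
apply: (@frob_lipschitz_fun_continuous _ _ _ L); split=> // Y Z.
apply: le_trans (gL Y Z).
by have := ler_coord_frob_norm (g Y - g Z) i j; rewrite !mxE.
Qed.

Lemma stiefel_frob_norm (R : realType) (n r : nat) (X : 'M[R]_(n, r)) :
  stiefel R n r X -> frob_norm X = Num.sqrt r%:R.
Proof. by rewrite /frob_norm /frob_dot => ->; rewrite mxtrace1. Qed.

Lemma stiefel_dist_le (R : realType) (n r : nat) (X Y : 'M[R]_(n, r)) :
  stiefel R n r X -> stiefel R n r Y ->
  frob_norm (X - Y) <= 2 * Num.sqrt r%:R.
Proof.
move=> SX SY; rewrite (le_trans (ler_frob_normD _ _))// frob_normN.
rewrite (stiefel_frob_norm SX) (stiefel_frob_norm SY); lra.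
Qed.

Lemma stiefel_closed (R : realType) (n r : nat) : closed (stiefel R n r).
Proof.
rewrite (_ : stiefel R n r = (fun X => X^T *m X) @^-1` [set 1%:M])//.
apply: closed_comp => [X _|].
  change ((fun Y : 'M[R]_(n, r) => Y^T *m Y) @ nbhs (X : 'M[R]_(n, r)) --> X^T *m X).
  by apply: cvg_mulmx; [apply: cvg_trmx|]; exact: cvg_id.
apply: (accessible_closed_set1 (hausdorff_accessible _)).
exact: norm_hausdorff.
Qed.

(** A box of matrices is the continuous image, under reshaping, of a box of row
    vectors, to which Tychonoff's theorem applies. *)
Lemma mx_box_compact (R : realType) (n r : nat) (a : R) :
  compact [set X : 'M[R]_(n, r) | forall i j, `|X i j| <= a].
Proof.
rewrite (_ : mkset _ = vec_mx @`
   [set v : 'rV[R]_(n * r) | forall k, `[- a, a]%classic (v ord0 k)]).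
  apply: continuous_compact; last first.
    apply: (@rV_compact R _ (fun=> `[- a, a]%classic)) => k.
    exact: segment_compact.
  apply: continuous_subspaceT => v.
  change (vec_mx @ nbhs (v : 'rV[R]_(n * r)) --> vec_mx v).
  apply: cvg_mx => i j.
  rewrite mxE; under eq_fun do rewrite mxE.
  exact: (@coord_continuous R 1 (n * r) _ _ v).
apply/seteqP; split=> [X Xa|_ [v va <-] i j].
  exists (mxvec X); last exact: mxvecK.
  by move=> k; case/mxvec_indexP : k => i j; rewrite mxvecE /= in_itv/= -ler_norml.
by rewrite mxE ler_norml; have := va (mxvec_index i j); rewrite /= in_itv.
Qed.

Lemma stiefel_compact (R : realType) (n r : nat) : compact (stiefel R n r).
Proof.
apply: subclosed_compact (@mx_box_compact R n r (Num.sqrt r%:R)) _.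
  exact: stiefel_closed.
by move=> X /stiefel_frob_norm <- i j; exact: ler_coord_frob_norm.
Qed.

(** * First-order expansions of the smooth part and of the retraction *)

(** The difference quotient of g along v at x + t v is literally that of
    s |-> g (x + s v) at t, which reduces directional derivatives to
    one-variable calculus. *)
Lemma is_derive_line (R : realType) (E W : normedModType R) (g : E -> W)
    (x v : E) (t : R) :
  derivable g (x + t *: v) v ->
  is_derive t (1 : R) (fun s : R => g (x + s *: v)) ('D_v g (x + t *: v)).
Proof.
have lineE : (fun s : R => s^-1 *: (((fun s : R => g (x + s *: v)) \o shift t) (s *: 1)
      - g (x + t *: v))) =
    (fun s : R => s^-1 *: ((g \o shift (x + t *: v)) (s *: v) - g (x + t *: v))).
  apply/funext => s /=; congr (_ *: (g _ - _)).
  by rewrite [s *: 1]mulr1 scalerDl addrCA.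
by move=> gv; split; rewrite /derivable /derive lineE.
Qed.

Lemma mx_sum_delta (R : realType) (n r : nat) (V : 'M[R]_(n, r)) :
  V = \sum_(ij : 'I_n * 'I_r) V ij.1 ij.2 *: delta_mx ij.1 ij.2.
Proof.
by rewrite {1}[V]matrix_sum_delta pair_bigA.
Qed.

Lemma derive_gradient (R : realType) (n r : nat) (f : 'M[R]_(n, r) -> R)
    (X V : 'M[R]_(n, r)) :
  differentiable f X -> 'D_V f X = frob_dot (gradient f X) V.
Proof.
move=> fX; rewrite deriveE// {1}[V]mx_sum_delta linear_sum frob_dotE.
by apply: eq_bigr => ij _; rewrite linearZ mxE deriveE// mulrC.
Qed.

(** The mean value theorem on the segment from X to Y gives the increment of f
    as <nabla f(Z), Y - X> with Z on the segment, and the Lipschitz bound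
    compares nabla f(Z) with nabla f(X). *)
Lemma lipschitz_gradient_taylor (R : realType) (n r : nat)
    (f : 'M[R]_(n, r) -> R) (L : R) (X Y : 'M[R]_(n, r)) :
  (forall Z, differentiable f Z) -> frob_lipschitz L (gradient f) ->
  `|f Y - f X - frob_dot (gradient f X) (Y - X)| <= L * frob_norm (Y - X) ^+ 2.
Proof.
move=> fd [L0 gL]; set D := Y - X.
have fline t : is_derive t (1 : R) (fun s : R => f (X + s *: D))
    (frob_dot (gradient f (X + t *: D)) D).
  by rewrite -derive_gradient//; apply: is_derive_line; exact: diff_derivable.
have [|c] := @MVT_segment R _ _ 0 1 ler01 (fun t _ => fline t).
  by apply: derivable_within_continuous => t _; have [] := fline t.
rewrite in_itv/= => /andP[c0 c1].
have XD : X + D = Y by rewrite addrC subrK.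
rewrite scale0r addr0 scale1r subr0 mulr1 XD => ->.
rewrite -frob_dotNl -frob_dotDl (le_trans (frob_cauchy_schwarz _ _))//.
rewrite expr2 mulrA ler_wpM2r ?frob_norm_ge0//.
rewrite (le_trans (gL _ _))// ler_wpM2l//.
by rewrite addrC addKr frob_normZ ger0_norm// ler_piMl ?frob_norm_ge0.
Qed.

Lemma nbhs_mx_ball (R : realType) (n r : nat) (A : set 'M[R]_(n, r))
    (X : 'M[R]_(n, r)) :
  nbhs X A -> exists2 b, 0 < b & forall Y, frob_norm (Y - X) < b -> A Y.
Proof.
move=> /nbhs_ballP[b /= b0 bA]; exists b => // Y XY; apply: bA.
split=> // i j; rewrite /ball /= (le_lt_trans _ XY)//.
by rewrite distrC; have := ler_coord_frob_norm (Y - X) i j; rewrite !mxE.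
Qed.

(** With G a smooth extension of R near (X0, 0), the curve t |-> G (X, t V) - t V
    has derivative D_(0,V) G (X, t V) - V, and V = D_(0,V) G (X, 0) because the
    differential of R_X at 0 is the identity. Writing D_(0,V) G as a combination
    of the finitely many partial derivatives D_(0,E_ij) G, which are continuous
    at (X0, 0), makes this derivative at most e ||V|| uniformly for X near X0
    and V small; the mean value theorem concludes entry by entry. *)
Lemma retraction_near (R : realType) (n r : nat)
    (Rt : 'M[R]_(n, r) -> 'M[R]_(n, r) -> 'M[R]_(n, r)) (X0 : 'M[R]_(n, r))
    (e : R) :
  retraction Rt -> stiefel R n r X0 -> 0 < e ->
  \forall X \near X0 & b \near 0^'+, stiefel R n r X ->
    forall V, tangent X V -> frob_norm V <= b ->
    frob_norm (Rt X V - X - V) <= e * frob_norm V.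
Proof.
move=> RtP SX0 e0.
have TB0 : tangent_bundle R n r (X0, 0).
  by split=> //=; rewrite /tangent /= trmx0 mul0mx mulmx0 addr0.
have [U [G [openU UX0 GC GRt]]] := retraction_smooth RtP TB0.
have /= [diffG contD] := GC 1%N.
pose N := #|{: 'I_n * 'I_r}|%:R : R.
pose e' := e / (N ^+ 2 + 1).
have N0 : 0 <= N by rewrite ler0n.
have e'0 : 0 < e' by rewrite divr_gt0//; nra.
pose inr V : 'M[R]_(n, r) * 'M[R]_(n, r) := (0, V).
pose Dij (ij : 'I_n * 'I_r) := 'D_(inr (delta_mx ij.1 ij.2)) G.
pose p0 : 'M[R]_(n, r) * 'M[R]_(n, r) := (X0, 0).
pose close (k : ('I_n * 'I_r) * ('I_n * 'I_r)) (z : 'M[R]_(n, r) * 'M[R]_(n, r)) :=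
  `|Dij k.1 p0 k.2.1 k.2.2 - Dij k.1 z k.2.1 k.2.2| <= e' / 2.
have : nbhs p0 (U `&` [set z | forall k, close k z]).
  apply: filterI; first exact: open_nbhs_nbhs.
  apply: (@filter_forall _ _ close _ (nbhs_filter p0)) => -[ij [a b]] /=.
  have Dc := contD (0, delta_mx ij.1 ij.2) _ UX0.
  have := @cvg_coord _ _ _ _ _ (nbhs_filter p0) _ _ a b Dc.
  by move=> /cvgrPdist_le; apply; rewrite divr_gt0.
move=> [[A B] /= [AX0 B0] AB].
have [b b0 bB] := nbhs_mx_ball B0.
exists (A, [set c | c < b]) => /=; first by split=> //; exact: nbhs_right_lt.
move=> [X c] /= [AX cb] SX V TV Vc.
have Vb t : `|t| <= 1 -> B (t *: V).
  move=> t1; apply: bB; rewrite subr0 frob_normZ.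
  rewrite (le_lt_trans _ cb)// (le_trans _ Vc)//.
  by rewrite ler_piMl ?frob_norm_ge0.
pose p t : 'M[R]_(n, r) * 'M[R]_(n, r) := (X, 0) + t *: (0, V).
have pE t : p t = (X, t *: V).
  by rewrite /p; congr pair; rewrite /= ?scaler0 ?addr0 ?add0r.
have Up t : `|t| <= 1 -> U (p t).
  by move=> t1; rewrite pE; have [] := AB (X, t *: V) (conj AX (Vb _ t1)).
have GE t : `|t| <= 1 -> G (p t) = Rt X (t *: V).
  move=> t1; rewrite GRt ?pE//; last by rewrite -pE; exact: Up.
  by split=> //=; exact: tangentZ.
have dG t : `|t| <= 1 -> is_derive t (1 : R) (G \o p) ('D_(0, V) G (p t)).
  by move=> t1; apply: is_derive_line; apply: diff_derivable; exact/diffG/Up.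
have t01 t : t \in `]0, 1[ -> `|t| <= 1 :> R.
  by rewrite in_itv/= => /andP[t0 t1]; rewrite ger0_norm ltW.
have t01' t : t \in `[0, 1] -> `|t| <= 1 :> R.
  by rewrite in_itv/= => /andP[t0 t1]; rewrite ger0_norm.
(* R and its extension G agree on the line for small t of either sign. *)
have DV0 : 'D_(0, V) G (p 0) = V.
  have d0 := retraction_diff0 RtP SX TV.
  have dG0 : is_derive (0 : R) (1 : R) (G \o p) ('D_(0, V) G (p 0)).
    by apply: dG; rewrite normr0.
  rewrite -[LHS](@derive_val _ _ _ _ _ _ _ dG0) -[RHS](@derive_val _ _ _ _ _ _ _ d0).
  apply: near_eq_derive; apply: filterS (nbhs0_lt (ltr01 : 0 < 1 :> R)) => t t1.
  by rewrite /= GE// ltW.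
have DVE t : `|t| <= 1 -> 'D_(0, V) G (p t) = \sum_ij V ij.1 ij.2 *: Dij ij (p t).
  move=> t1; rewrite deriveE; last exact/diffG/Up.
  have -> : (0, V) = \sum_ij V ij.1 ij.2 *: inr (delta_mx ij.1 ij.2).
    rewrite -/(inr V) [in LHS](mx_sum_delta V).
    rewrite (big_morph inr (id1 := 0) (op1 := +%R))//.
      by apply: eq_bigr => ij _; congr pair; rewrite /= scaler0.
    by move=> W W'; congr pair; rewrite /= addr0.
  rewrite linear_sum; apply: eq_bigr => ij _.
  by rewrite linearZ /Dij deriveE//; exact/diffG/Up.
have c0p t : `|t| <= 1 -> forall k, close k (p t).
  by move=> t1 k; rewrite pE; have [] := AB (X, t *: V) (conj AX (Vb _ t1)).
have entry i j : `|(Rt X V - X - V) i j| <= N * e' * frob_norm V.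
  pose phi t : R := G (p t) i j - t * V i j.
  have dphi t : `|t| <= 1 -> is_derive t (1 : R) phi (('D_(0, V) G (p t) - V) i j).
    move=> t1; have dGt := dG t t1.
    have dGij : is_derive t (1 : R) (fun s => (G \o p) s i j) ('D_(0, V) G (p t) i j).
      have [Gd GdE] := dGt; split; first by move/derivable_mxP : Gd; apply.
      by rewrite -GdE derive_mx// mxE.
    have dlin : is_derive t (1 : R) (fun s : R => s * V i j) (V i j).
      rewrite (_ : (fun s : R => s * V i j) = V i j \*: id); last first.
        by apply/funext => s /=; rewrite mulrC.
      by apply: is_derive_eq; rewrite [LHS]mulr1.
    by rewrite !mxE; exact: is_deriveB.
  have [|c0] := @MVT_segment R phi _ 0 1 ler01 (fun t tt => dphi t (t01 t tt)).
    apply: derivable_within_continuous => t /t01' t1; by have [] := dphi t t1.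
  move=> /t01' c01.
  rewrite /phi !GE ?normr1 ?normr0// scale1r scale0r (retraction0 RtP)//.
  rewrite mul1r mul0r !subr0 mulr1 => EQ.
  have -> : (Rt X V - X - V) i j = ('D_(0, V) G (p c0) - V) i j.
    by rewrite -EQ !mxE; ring.
  rewrite -{2}DV0 !DVE ?normr0// -sumrB summxE.
  apply: (@le_trans _ _ (\sum_(k : 'I_n * 'I_r) e' * frob_norm V)); last first.
    by rewrite sumr_const -[_ *+ _]mulr_natl mulrA.
  rewrite (le_trans (ler_norm_sum _ _ _))//; apply: ler_sum => k _.
  rewrite -scalerBr !mxE normrM mulrC distrC ler_pM// ?ler_coord_frob_norm//.
  have := c0p _ c01 (k, (i, j)); have := c0p 0 _ (k, (i, j)); rewrite normr0 /close /=.
  move=> /(_ ler01) H0 H1; rewrite -(subrKA (Dij k p0 i j)) (splitr e').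
  by rewrite (le_trans (ler_normD _ _))// lerD// distrC.
apply: le_trans (ler_frob_norm_sum _) _.
apply: (@le_trans _ _ (\sum_(ij : 'I_n * 'I_r) N * e' * frob_norm V)).
  by apply: ler_sum => ij _; exact: entry.
rewrite sumr_const -[_ *+ _]mulr_natl -/N mulrA ler_wpM2r ?frob_norm_ge0//.
rewrite mulrA -expr2 /e' mulrA ler_pdivrMr ?ltr_wpDl ?sqr_ge0//.
by rewrite mulrDr mulr1 mulrC lerDl ltW.
Qed.

(** The radius found near each point of the manifold can be chosen uniformly by
    compactness. *)
Lemma retraction_uniform (R : realType) (n r : nat)
    (Rt : 'M[R]_(n, r) -> 'M[R]_(n, r) -> 'M[R]_(n, r)) (e : R) :
  retraction Rt -> 0 < e ->
  exists2 b, 0 < b & forall X V, stiefel R n r X -> tangent X V ->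
    frob_norm V <= b -> frob_norm (Rt X V - X - V) <= e * frob_norm V.
Proof.
move=> RtP e0.
have := @compact_near_coveringP _ (stiefel R n r).
move=> [/(_ (@stiefel_compact R n r)) cover _].
have near_b := cover _ (0^'+ : set_system R) _ _
  (fun X0 SX0 => retraction_near RtP SX0 e0).
have [b [bP b0]] : exists b, (stiefel R n r `<=` (fun X => stiefel R n r X ->
    forall V, tangent X V -> frob_norm V <= b ->
    frob_norm (Rt X V - X - V) <= e * frob_norm V)) /\ 0 < b.
  apply: (@filter_ex _ (0^'+ : set_system R)).
  by apply: filterI; [exact: near_b|exact: nbhs_right_gt].
by exists b => // X V SX; exact: bP.
Qed.

(** * Nonmonotone descent of real sequences *)

Lemma le_window_max (R : realType) (a : nat -> R) (m k j : nat) :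
  (k - m <= j <= k)%N -> a j <= \big[Num.max/a k]_(k - m <= i < k.+1) a i.
Proof.
move=> jk; apply: le_bigmax_seq => //.
by rewrite mem_index_iota ltnS.
Qed.


Lemma window_max_attained (R : realType) (a : nat -> R) (m k : nat) :
  exists2 j, (k - m <= j <= k)%N &
    \big[Num.max/a k]_(k - m <= i < k.+1) a i = a j.
Proof.
rewrite big_seq_cond; elim/big_ind : _ => [|x y [i ik ->] [j jk ->]|i].
- by exists k; rewrite // leq_subr leqnn.
- by case: leP => _; [exists j|exists i].
- by rewrite mem_index_iota ltnS andbT => ik; exists i.
Qed.

(** The maxima of a over the windows of m + 1 consecutive indices do not
    increase, hence tend to their infimum l. If a k.+1 is close to l then the
    decrease inequality makes d k small, and then a k is close to l too, since a
    increases by at most C d k. Every window contains an index where a is at least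
    l; going back from it, in at most m steps, shows that all late values of a
    are close to l, and so all late d k are small. *)
Lemma nonmonotone_descent (R : realType) (a d : nat -> R) (b c C : R) (m : nat) :
  0 < c -> 0 <= C -> (forall k, 0 <= d k) -> (forall k, b <= a k) ->
  (forall k, a k.+1 <= \big[Num.max/a k]_(k - m <= j < k.+1) a j - c * d k ^+ 2) ->
  (forall k, a k.+1 - a k <= C * d k) ->
  forall e, 0 < e -> exists K, forall k, (K <= k)%N -> d k <= e.
Proof.
move=> c0 C0 d0 ab decr step.
pose M k := \big[Num.max/a k]_(k - m <= j < k.+1) a j.
have MS k : M k.+1 <= M k.
  rewrite {1}/M; have [j /andP[j1 j2] ->] := window_max_attained a m k.+1.
  move: j2; rewrite leq_eqVlt => /predU1P[->|j2].
    by rewrite (le_trans (decr k))// gerBl mulr_ge0 ?sqr_ge0// ltW.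
  apply: le_window_max; apply/andP; split; last by rewrite -ltnS.
  by rewrite (leq_trans _ j1)// leq_sub2r.
have Mle : {homo M : i j / (i <= j)%N >-> j <= i}.
  by apply: homo_leq => // [x y z yx zy]; exact: le_trans zy yx.
pose l := inf (range M).
have rM : has_inf (range M).
  split; first by exists (M 0%N), 0%N.
  exists b => _ [k _ <-]; rewrite /M.
  by have [j _ ->] := window_max_attained a m k.
have lM k : l <= M k by apply: (ge_inf (proj2 rM)); exists k.
have Ml e : 0 < e -> exists K, forall k, (K <= k)%N -> M k <= l + e.
  move=> e0; have [_ [K _ <-] KM] := inf_adherent e0 rM.
  by exists K => k Kk; rewrite (le_trans (Mle _ _ Kk))// ltW.
have close e : 0 < e -> exists2 e', 0 < e' & exists K, forall k, (K <= k)%N ->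
    l - e' <= a k.+1 -> d k <= e.
  move=> e0; exists (c * e ^+ 2 / 2).
    by rewrite divr_gt0// mulr_gt0// exprn_gt0.
  have [|K KM] := Ml (c * e ^+ 2 / 2).
    by rewrite divr_gt0// mulr_gt0// exprn_gt0.
  exists K => k /KM Mk ak.
  have : c * d k ^+ 2 <= c * e ^+ 2.
    by have := decr k; rewrite -/(M k); lra.
  by rewrite ler_pM2l// ler_pXn2r ?nnegrE// ltW.
have back i e : 0 < e -> exists K, forall k, (K <= k)%N ->
    forall j, (j <= i)%N -> l <= a (k + j)%N -> l - e <= a k.
  elim: i e => [|i IH] e e0.
    by exists 0%N => k _ j; rewrite leqn0 => /eqP ->; rewrite addn0; lra.
  have C1 : 0 < C + 1 by lra.
  have [|e1 e10 [K1 K1d]] := close (e / 2 / (C + 1)); first by rewrite !divr_gt0.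
  have [|K2 K2a] := IH (Num.min e1 (e / 2)); first by rewrite lt_min e10 divr_gt0.
  exists (maxn K1 K2) => k; rewrite geq_max => /andP[K1k K2k] [_|j ji].
    by rewrite addn0; lra.
  rewrite addnS -addSn => /(K2a _ (leqW K2k) _ ji).
  set e2 := Num.min e1 (e / 2) => ak.
  have [e21 e22] : e2 <= e1 /\ e2 <= e / 2 by rewrite !ge_min !lexx orbT.
  have /(K1d _ K1k) dk : l - e1 <= a k.+1 by apply: le_trans ak; rewrite lerB.
  have Cd : C * d k <= e / 2.
    by move: dk; rewrite ler_pdivlMr//; have := d0 k; nra.
  have := step k; lra.
move=> e e0; have [e1 e10 [K1 K1d]] := close _ e0.
have [K2 K2a] := back m _ e10.
exists (maxn K1 K2) => k; rewrite geq_max => /andP[K1k K2k].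
apply: K1d => //.
(* The window ending at k + m + 1 starts at k + 1. *)
have [j /andP[j1 j2] aj] := window_max_attained a m (k + m.+1).
rewrite addnS -addSn addnK in j1.
apply: (K2a _ (leqW K2k) (j - k.+1)%N).
  by rewrite leq_subLR addSn -addnS.
by rewrite subnKC// -aj; exact: lM.
Qed.

(** * Extension of linear minorants of a convex function *)

Lemma convex_functionP (R : realType) (E : lmodType R) (q : E -> R) :
  convex_function setT q -> forall x y t, 0 <= t <= 1 ->
  q (t *: x + (1 - t) *: y) <= t * q x + (1 - t) * q y.
Proof.
move=> qc x y t /andP[t0 t1].
by have := qc (Itv01 t0 t1) x y (in_setT _) (in_setT _).
Qed.

(** One step of the Hahn-Banach argument. S is the graph of the negative of a
    linear form on a subspace, more generally any convex set of pairs (x, l)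
    with q x + l >= 0. The slope c to be given to the new direction v must lie
    above the quotients - (q (x + t v) + l) / t and below the quotients
    (q (x - s v) + l) / s for s, t > 0; convexity of q orders the former below
    the latter. *)
Lemma convex_extension_step (R : realType) (E : lmodType R) (q : E -> R)
    (S : set (E * R)) (v : E) :
  convex_function setT q ->
  (forall z w t, S z -> S w -> 0 <= t <= 1 ->
    S (t *: z.1 + (1 - t) *: w.1, t * z.2 + (1 - t) * w.2)) ->
  (forall z, S z -> 0 <= q z.1 + z.2) ->
  exists c, forall z t, S z -> 0 <= q (z.1 + t *: v) + z.2 + t * c.
Proof.
move=> /convex_functionP qc Sc S0.
have [->|/set0P[z0 Sz0]] := eqVneq S set0; first by exists 0.
(* The weights s / (s + t) and t / (s + t) cancel v. *)
have cross z w t s : S z -> S w -> 0 < t -> 0 < s ->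
    - (q (z.1 + t *: v) + z.2) / t <= (q (w.1 - s *: v) + w.2) / s.
  move=> Sz Sw t0 s0; have st0 : 0 < s + t by rewrite addr_gt0.
  pose u := s / (s + t).
  have u01 : 0 <= u <= 1.
    rewrite divr_ge0 ?(ltW s0) ?(ltW st0)//= ler_pdivrMr// mul1r lerDl.
    exact: ltW.
  have u1 : 1 - u = t / (s + t) by rewrite /u; field; rewrite gt_eqF.
  have /S0/= := Sc _ _ _ Sz Sw u01.
  have := qc (z.1 + t *: v) (w.1 - s *: v) _ u01.
  have -> : u *: (z.1 + t *: v) + (1 - u) *: (w.1 - s *: v) =
            u *: z.1 + (1 - u) *: w.1.
    rewrite !scalerDr addrACA scalerN !scalerA u1 -scalerBl.
    rewrite (_ : _ - _ = 0) ?scale0r ?addr0// /u; field.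
    by rewrite gt_eqF.
  set d := q _; set a := q _; set b := q _ => H1 H2.
  have : 0 <= (s + t) * (u * (a + z.2) + (1 - u) * (b + w.2)).
    by rewrite mulr_ge0 ?(ltW st0)//; lra.
  rewrite u1 /u; set X := (X in 0 <= X) => X0.
  have XE : X = s * (a + z.2) + t * (b + w.2) by rewrite /X; field; rewrite gt_eqF.
  rewrite ler_pdivrMr// mulrAC ler_pdivlMr//; lra.
pose A := [set x | exists z t, [/\ S z, 0 < t & x = - (q (z.1 + t *: v) + z.2) / t]].
have Aub w s : S w -> 0 < s -> ubound A ((q (w.1 - s *: v) + w.2) / s).
  by move=> Sw s0 _ [z [t [Sz t0 ->]]]; exact: cross.
have A0 : A !=set0 by exists (- (q (z0.1 + 1 *: v) + z0.2) / 1), z0, 1.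
exists (sup A) => z t Sz.
have [t0|t0|<-] := ltgtP 0 t.
- have : - (q (z.1 + t *: v) + z.2) / t <= sup A.
    apply: ub_le_sup; first by exists ((q (z0.1 - 1 *: v) + z0.2) / 1); exact: Aub.
    by exists z, t.
  by rewrite ler_pdivrMr//; lra.
- have nt0 : 0 < - t by rewrite oppr_gt0.
  have : sup A <= (q (z.1 - (- t) *: v) + z.2) / - t.
    by apply: ge_sup => //; exact: Aub.
  by rewrite ler_pdivlMr// scaleNr opprK; lra.
- by rewrite scale0r mul0r !addr0; exact: S0.
Qed.

(** The directions v i need not be independent, neither mutually nor from S: the
    slopes are attached to the indices, so that no basis of a complement has to
    be chosen. *)
Lemma convex_extension (R : realType) (E : lmodType R) (I : eqType) (s : seq I)
    (v : I -> E) (q : E -> R) (S : set (E * R)) :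
  uniq s -> convex_function setT q ->
  (forall z w t, S z -> S w -> 0 <= t <= 1 ->
    S (t *: z.1 + (1 - t) *: w.1, t * z.2 + (1 - t) * w.2)) ->
  (forall z, S z -> 0 <= q z.1 + z.2) ->
  exists c : I -> R, forall z (t : I -> R), S z ->
    0 <= q (z.1 + \sum_(i <- s) t i *: v i) + z.2 + \sum_(i <- s) t i * c i.
Proof.
move=> us qc; elim: s S us => [|i s IH] S /=.
  move=> _ _ S0; exists (fun=> 0) => z t /S0.
  by rewrite !big_nil !addr0.
move=> /andP[si us] Sc S0.
have [c cP] := convex_extension_step (v i) qc Sc S0.
pose S' := [set zt : E * R | exists z t, S z /\
              zt = (z.1 + t *: v i, z.2 + t * c)].
have [||c' c'P] := IH S' us.
- move=> _ _ u [z [t [Sz ->]]] [w [t' [Sw ->]]] u01.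
  exists (u *: z.1 + (1 - u) *: w.1, u * z.2 + (1 - u) * w.2).
  exists (u * t + (1 - u) * t'); split; first exact: Sc.
  congr pair => /=; last by ring.
  by rewrite !scalerDr addrACA !scalerA -scalerDl.
- by move=> _ [z [t [Sz ->]]] /=; rewrite addrA; exact: cP.
exists (fun j => if j == i then c else c' j) => z t Sz.
have /(c'P _ t) /= : S' (z.1 + t i *: v i, z.2 + t i * c) by exists z, (t i).
rewrite !big_cons eqxx !addrA; congr (0 <= _ + _).
rewrite [LHS]big_seq [RHS]big_seq; apply: eq_bigr => j js.
by case: eqP js si => // -> ->.
Qed.

(** The nonnegative convex function q U = <g, U> + h(X + U) - h(X) on the tangent
    space is extended in the directions E_ij - P E_ij, with P the tangent
    projection. As U = P U + sum_ij U_ij (E_ij - P E_ij), the slopes form a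
    matrix C such that q U + <C, U> >= 0 for every U, which says that
    - (g + C) is a subgradient. For tangent U the sum vanishes, so <C, U> >= 0
    for U and - U, and C is normal. *)
Lemma normal_subgradient (R : realType) (n r : nat) (h : 'M[R]_(n, r) -> R)
    (X g : 'M[R]_(n, r)) :
  convex_function setT h -> stiefel R n r X ->
  (forall U, tangent X U -> 0 <= frob_dot g U + (h (X + U) - h X)) ->
  exists2 W, subdifferential h X W & tangent_proj X (g + W) = 0.
Proof.
move=> /convex_functionP hc SX opt; pose P := tangent_proj X.
pose q U := frob_dot g U + (h (X + U) - h X).
have qc : convex_function setT q.
  move=> t x y _ _.
  have u01 : 0 <= t%:num <= (1 : R) by apply/andP; split.
  set u := t%:num in u01 *.
  change (q (u *: x + (1 - u) *: y) <= u * q x + (1 - u) * q y).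
  have := hc (X + x) (X + y) u u01.
  have -> : u *: (X + x) + (1 - u) *: (X + y) = X + (u *: x + (1 - u) *: y).
    by rewrite !scalerDr addrACA -scalerDl [u + _]addrC subrK scale1r.
  by rewrite /q !frob_dot_lin; lra.
pose v (ij : 'I_n * 'I_r) : 'M[R]_(n, r) := delta_mx ij.1 ij.2 - P (delta_mx ij.1 ij.2).
have vE (U : 'M[R]_(n, r)) : \sum_ij U ij.1 ij.2 *: v ij = U - P U.
  rewrite {2}(mx_sum_delta U) (mx_sum_delta U) /P.
  rewrite (big_morph (tangent_proj X) (@tangent_projD _ _ _ X) (id1 := 0)); last first.
    by rewrite -(scale0r 0) tangent_projZ !scale0r.
  rewrite -sumrB; apply: eq_bigr => ij _.
  by rewrite -mx_sum_delta tangent_projZ scalerBr.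
pose S : set ('M[R]_(n, r) * R) := [set z | tangent X z.1 /\ z.2 = 0].
have [| |c cP] := convex_extension v (S := S) (index_enum_uniq _) qc.
- move=> [z1 z2] [w1 w2] t [/= Tz ->] [/= Tw ->] _.
  split=> /=; last by rewrite !mulr0 addr0.
  rewrite -(tangent_proj_id Tz) -(tangent_proj_id Tw) -!tangent_projZ -tangent_projD.
  exact: tangent_proj_tangent.
- by move=> [z1 z2] [/= Tz ->]; rewrite addr0; exact: opt.
pose C : 'M[R]_(n, r) := \matrix_(i, j) c (i, j).
have CE (U : 'M[R]_(n, r)) : \sum_ij U ij.1 ij.2 * c ij = frob_dot U C.
  by rewrite frob_dotE; apply: eq_bigr => -[i j] _; rewrite mxE.
have qC U : 0 <= q U + frob_dot U C.
  have SU : S (P U, 0) by split=> //; exact: tangent_proj_tangent.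
  have := cP _ (fun ij => U ij.1 ij.2) SU.
  by rewrite /= vE CE addr0 addrC [P U + _]addrC subrK addrC.
have CT U : tangent X U -> 0 <= frob_dot U C.
  move=> TU; have S0 : S (0, 0) by split=> //; exact: tangent0.
  have := cP _ (fun ij => U ij.1 ij.2) S0.
  rewrite /= vE CE /P (tangent_proj_id TU) subrr !addr0 /q addr0 subrr.
  by rewrite frob_dot0r !add0r.
exists (- (g + C)) => [Y /=|].
  have := qC (Y - X); rewrite /q (frob_dotC _ C) [X + _]addrC subrK.
  by rewrite frob_dotNl frob_dotDl; lra.
rewrite opprD addrA subrr add0r; apply: frob_norm_eq0.
rewrite -scaleN1r tangent_projZ frob_normZ normrN1 mul1r.
apply/eqP; rewrite -sqrf_eq0 sqr_frob_norm; set D := tangent_proj X C.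
have TD : tangent X D by exact: tangent_proj_tangent.
have DD : frob_dot D D = frob_dot D C.
  by rewrite /D tangent_proj_sym (tangent_proj_id TD) frob_dotC.
have := CT _ TD; have := CT _ (tangentZ (-1) TD); rewrite frob_dotZl mulN1r -DD.
by rewrite oppr_ge0 => H1 H2; rewrite eq_le H1 H2.
Qed.

(** * Decrease of the objective along one step *)

Lemma varrho_ge0 (R : realType) (n r : nat) (f : 'M[R]_(n, r) -> R) :
  0 <= varrho f.
Proof.
rewrite /varrho; set S := (X in sup X).
have [supS|/sup_out->//] := pselect (has_sup S).
have [[x Sx] ubS] := supS; have [X _ xE] := Sx.
apply: le_trans (ub_le_sup ubS Sx).
by rewrite -xE frob_norm_ge0.
Qed.

Lemma kappa1_gt0 (R : realType) (L rho delta : R) (p : nat) :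
  0 <= L -> 0 <= rho -> 0 < delta -> 0 < kappa1 L rho delta p.
Proof.
move=> L0 rho0 delta0; rewrite /kappa1 invr_gt0.
set u := upsilon _ _ _; have u1 : 1 < u.
  by rewrite /u /upsilon ltr_pdivlMr// mul1r; lra.
have up : 1 <= u ^+ (2 * p) by rewrite exprn_ege1// ltW.
have u2 : 1 < u ^+ 2 by rewrite exprn_egt1.
apply: ltr_wpDl; last by rewrite divr_gt0// (lt_le_trans ltr01).
by rewrite mulr_ge0// divr_ge0// ?subr_ge0// ltW.
Qed.

Lemma sqnorm_opZ (R : realType) (n r : nat) (X : 'M[R]_(n, r))
    (B : 'M[R]_(n, r) -> 'M[R]_(n, r)) (a : R) (V : 'M[R]_(n, r)) :
  spd_on_tangent X B -> tangent X V ->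
  sqnorm_op B (a *: V) = a ^+ 2 * sqnorm_op B V.
Proof.
move=> BP TV; have T0 := tangent0 X.
have B0 : B 0 = 0.
  have := spd_linear BP 1 T0 T0; rewrite !scale1r addr0 => /eqP.
  by rewrite -subr_eq0 opprD addNKr oppr_eq0 => /eqP.
have BZ : B (a *: V) = a *: B V.
  by rewrite -[a *: V]addr0 (spd_linear BP _ TV T0) B0 addr0.
rewrite /sqnorm_op BZ.
by rewrite !frob_dot_lin mulrA expr2.
Qed.

(** Comparing V with s V for s < 1, and using convexity of h on the segment, gives
    A <= - (1 + s) / 2 * q for A = <nabla f(X), V> + h(X + V) - h(X) and
    q = ||V||_B^2; then s tends to 1. The general t follows from the case t = 1
    by convexity of h once more. *)
Lemma sub_argmin_decrease (R : realType) (n r : nat) (f h : 'M[R]_(n, r) -> R)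
    (B : 'M[R]_(n, r) -> 'M[R]_(n, r)) (X V : 'M[R]_(n, r)) (t : R) :
  convex_function setT h -> spd_on_tangent X B -> tangent X V ->
  (forall U, tangent X U -> sub_objective f h B X V <= sub_objective f h B X U) ->
  0 <= sqnorm_op B V -> 0 <= t <= 1 ->
  t * frob_dot (gradient f X) V + (h (X + t *: V) - h X) <= - (t * sqnorm_op B V).
Proof.
move=> /convex_functionP hc BP TV Vmin q0 t01.
set g := frob_dot (gradient f X) V; set q := sqnorm_op B V in q0 *.
have hline s : 0 <= s <= 1 -> h (X + s *: V) <= s * h (X + V) + (1 - s) * h X.
  move=> s01; have := hc (X + V) X s s01; congr (h _ <= _).
  by rewrite scalerDr addrAC -scalerDl [s + _]addrC subrK scale1r.
suff : g + h (X + V) - h X <= - q by have := hline _ t01; case/andP: t01; nra.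
rewrite leNgt; apply/negP => Aq.
have min s : 0 <= s <= 1 -> g + q / 2 + h (X + V) <=
    s * g + s ^+ 2 * q / 2 + (s * h (X + V) + (1 - s) * h X).
  move=> s01; have := Vmin _ (tangentZ s TV); have := hline _ s01.
  by rewrite /sub_objective (sqnorm_opZ _ BP TV) frob_dotZr -/g -/q; lra.
set A := g + h (X + V) - h X in Aq.
have minA s : 0 <= s <= 1 -> (1 - s) * (A + q) <= (1 - s) ^+ 2 * q / 2.
  by move=> /min; rewrite /A; nra.
have q1 : 0 < q.
  by have := minA 0; rewrite lexx ler01 => /(_ isT); lra.
(* If A + q > 0, the value of s for which (1 - s) q = A + q contradicts minA. *)
pose s := 1 - (A + q) / q.
have sq : (1 - s) * q = A + q by rewrite /s opprB addrC subrK divfK// gt_eqF.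
have := minA 0; rewrite lexx ler01 => /(_ isT) H0.
have s1 : 0 < 1 - s by rewrite /s opprB addrC subrK divr_gt0//; lra.
have s01 : 0 <= s <= 1 by apply/andP; split; nra.
have := minA _ s01; nra.
Qed.

Lemma stiefel_gradient_bounded (R : realType) (n r : nat)
    (f : 'M[R]_(n, r) -> R) (L : R) (X0 : 'M[R]_(n, r)) :
  frob_lipschitz L (gradient f) -> stiefel R n r X0 ->
  exists2 K, 0 <= K & forall X, stiefel R n r X -> frob_norm (gradient f X) <= K.
Proof.
move=> [L0 gL] SX0; pose s := Num.sqrt r%:R : R.
exists (frob_norm (gradient f X0) + L * (2 * s)).
  by rewrite addr_ge0 ?frob_norm_ge0// !mulr_ge0// sqrtr_ge0.
move=> X SX; rewrite -[gradient f X](subrK (gradient f X0)) addrC.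
rewrite (le_trans (ler_frob_normD _ _))// lerD2l (le_trans (gL _ _))// ler_wpM2l//.
exact: stiefel_dist_le.
Qed.

Lemma objective_lipschitz_stiefel (R : realType) (n r : nat)
    (f h : 'M[R]_(n, r) -> R) (L Lh K : R) :
  (forall Z, differentiable f Z) -> frob_lipschitz L (gradient f) ->
  frob_lipschitz_fun Lh h -> 
  (forall X, stiefel R n r X -> frob_norm (gradient f X) <= K) ->
  forall X Y, stiefel R n r X -> stiefel R n r Y ->
  (f \+ h) Y - (f \+ h) X <= (K + L * (2 * Num.sqrt r%:R) + Lh) * frob_norm (Y - X).
Proof.
move=> fd gL [_ hL] gK X Y SX SY /=; have [L0 _] := gL.
have := le_trans (ler_norm _) (hL Y X).
have := le_trans (ler_norm _) (lipschitz_gradient_taylor X Y fd gL).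
have := le_trans (ler_norm _) (frob_cauchy_schwarz (gradient f X) (Y - X)).
have : frob_norm (gradient f X) * frob_norm (Y - X) <= K * frob_norm (Y - X).
  by rewrite ler_wpM2r ?frob_norm_ge0// gK.
have : L * frob_norm (Y - X) ^+ 2 <= L * (2 * Num.sqrt r%:R) * frob_norm (Y - X).
  by rewrite expr2 -!mulrA ler_wpM2l// mulrA ler_wpM2r ?frob_norm_ge0// stiefel_dist_le.
lra.
Qed.

(** Y stands for the retracted point, E = Y - X - t V for the retraction error.
    Both f (by its Taylor bound) and h (by its Lipschitz bound) see E only
    through its size; e <= 1 gives ||Y - X|| <= 2 t ||V||, whence the factor 4. *)
Lemma objective_retraction_decrease (R : realType) (n r : nat)
    (f h : 'M[R]_(n, r) -> R) (L Lh K e t q : R) (X V Y : 'M[R]_(n, r)) :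
  (forall Z, differentiable f Z) -> frob_lipschitz L (gradient f) ->
  frob_lipschitz_fun Lh h -> frob_norm (gradient f X) <= K ->
  t * frob_dot (gradient f X) V + (h (X + t *: V) - h X) <= - (t * q) ->
  0 <= t -> 0 <= e <= 1 ->
  frob_norm (Y - X - t *: V) <= e * (t * frob_norm V) ->
  (f \+ h) Y - (f \+ h) X <= - (t * q) + (K + Lh) * e * (t * frob_norm V)
     + 4 * L * (t * frob_norm V) ^+ 2.
Proof.
move=> fd gL [Lh0 hL] gK model t0 /andP[e0 e1] YV /=; have [L0 _] := gL.
set w := t * frob_norm V in YV *; set E := Y - X - t *: V in YV.
have w0 : 0 <= w by rewrite mulr_ge0 ?frob_norm_ge0.
have YX : Y - X = t *: V + E by rewrite /E [RHS]addrC subrK.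
have YXw : frob_norm (Y - X) <= 2 * w.
  rewrite YX (le_trans (ler_frob_normD _ _))// frob_normZ ger0_norm//.
  by rewrite -/w; nra.
have hY : h Y - h (X + t *: V) <= Lh * (e * w).
  rewrite (le_trans (ler_norm _))// (le_trans (hL _ _))// ler_wpM2l//.
  by rewrite opprD addrA.
have := le_trans (ler_norm _) (lipschitz_gradient_taylor X Y fd gL).
have : L * frob_norm (Y - X) ^+ 2 <= L * (2 * w) ^+ 2.
  by rewrite ler_wpM2l// ler_pXn2r ?nnegrE ?frob_norm_ge0// mulr_ge0.
have gE : frob_dot (gradient f X) E <= K * (e * w).
  rewrite (le_trans (ler_norm _))// (le_trans (frob_cauchy_schwarz _ _))//.
  by rewrite ler_pM ?frob_norm_ge0.
rewrite {2}YX frob_dotDr frob_dotZr; lra.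
Qed.

(** * The iterates *)

Lemma manPQN_stiefel (R : realType) (n r : nat) (f h : 'M[R]_(n, r) -> R)
    (Rt : 'M[R]_(n, r) -> 'M[R]_(n, r) -> 'M[R]_(n, r)) (gamma sigma : R) (m : nat)
    (B : nat -> 'M[R]_(n, r) -> 'M[R]_(n, r)) (X V : nat -> 'M[R]_(n, r))
    (N : nat -> nat) :
  retraction Rt -> manPQN f h Rt gamma sigma m B X V N ->
  forall k, stiefel R n r (X k).
Proof.
move=> RtP XP; elim=> [|k IH]; first exact: manPQN_init XP.
rewrite (manPQN_step XP); apply: (retraction_stiefel RtP) => //.
exact/tangentZ/(manPQN_tangent XP).
Qed.

(** For short V this is the uniform expansion with constant 1; for long V the
    manifold is bounded, so the displacement is at most a multiple of ||V||. *)
Lemma retraction_displacement (R : realType) (n r : nat)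
    (Rt : 'M[R]_(n, r) -> 'M[R]_(n, r) -> 'M[R]_(n, r)) :
  retraction Rt -> exists2 C, 0 <= C & forall X V, stiefel R n r X ->
    tangent X V -> frob_norm (Rt X V - X) <= C * frob_norm V.
Proof.
move=> RtP; have [b b0 bP] := retraction_uniform RtP (@ltr01 R).
have s0 := sqrtr_ge0 (r%:R : R).
have sb : 0 <= 2 * Num.sqrt r%:R / b by rewrite divr_ge0 ?mulr_ge0// ltW.
exists (2 + 2 * Num.sqrt r%:R / b) => [|X V SX TV]; first by rewrite addr_ge0.
have v0 := frob_norm_ge0 V.
have [Vb|bV] := leP (frob_norm V) b.
  have /(le_trans (ler_frob_normD _ _)) :
      frob_norm (Rt X V - X - V) + frob_norm V <= 2 * frob_norm V.
    by have := bP _ _ SX TV Vb; lra.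
  by rewrite subrK => /le_trans; apply; rewrite ler_wpM2r// lerDl.
rewrite (le_trans (stiefel_dist_le (retraction_stiefel RtP SX TV) SX))//.
apply: (@le_trans _ _ (2 * Num.sqrt r%:R / b * frob_norm V)); last first.
  by rewrite [leRHS]mulrDl lerDr mulr_ge0.
by rewrite mulrAC ler_pdivlMr// ler_wpM2l ?mulr_ge0// ltW.
Qed.

(** First alpha_k ||V_k|| tends to 0 by [nonmonotone_descent]; the inequality
    alpha_k <= 1 is used to pass from alpha_k ||V_k||^2 to its square. If
    ||V_k|| > e for a late k, the trial step preceding the accepted one has
    length at most tau, where the first-order errors of F are dominated by half
    of the model decrease, so it satisfies the acceptance test: a contradiction. *)
Lemma manPQN_steps_vanish (R : realType) (n r : nat) (f h : 'M[R]_(n, r) -> R)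
    (Rt : 'M[R]_(n, r) -> 'M[R]_(n, r) -> 'M[R]_(n, r))
    (L Lh gamma sigma k1 : R) (m : nat)
    (B : nat -> 'M[R]_(n, r) -> 'M[R]_(n, r)) (X V : nat -> 'M[R]_(n, r))
    (N : nat -> nat) :
  (forall Y, differentiable f Y) -> frob_lipschitz L (gradient f) ->
  convex_function setT h -> frob_lipschitz_fun Lh h -> retraction Rt ->
  0 < gamma -> gamma < 1 -> 0 < sigma -> sigma < 1 ->
  manPQN f h Rt gamma sigma m B X V N -> 0 < k1 ->
  (forall k W, tangent (X k) W -> k1 * frob_norm W ^+ 2 <= sqnorm_op (B k) W) ->
  forall e, 0 < e -> exists K, forall k, (K <= k)%N -> frob_norm (V k) <= e.
Proof.
move=> fd gL hc hL RtP gamma0 gamma1 sigma0 sigma1 XP k10 Bk1 e e0.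
have SX := manPQN_stiefel RtP XP.
have TV := manPQN_tangent XP.
have [L0 _] := gL; have [Lh0 _] := hL.
have [K K0 gK] := stiefel_gradient_bounded gL (SX 0%N).
pose F := f \+ h; set s := Num.sqrt r%:R : R.
have s0 : 0 <= s by exact: sqrtr_ge0.
pose CF := K + L * (2 * s) + Lh.
have CF0 : 0 <= CF by rewrite !addr_ge0 ?mulr_ge0.
have FL Y Z : stiefel R n r Y -> stiefel R n r Z -> F Z - F Y <= CF * frob_norm (Z - Y).
  exact: (objective_lipschitz_stiefel fd gL hL gK).
have [C C0 RtC] := retraction_displacement RtP.
pose alpha k := gamma ^+ N k.
have alpha0 k : 0 < alpha k by rewrite exprn_gt0.
have alpha1 k : alpha k <= 1 by rewrite exprn_ile1// ltW.
pose d k := frob_norm (alpha k *: V k).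
have dE k : d k = alpha k * frob_norm (V k).
  by rewrite /d frob_normZ gtr0_norm.
have qV k : k1 * frob_norm (V k) ^+ 2 <= sqnorm_op (B k) (V k) by exact: Bk1.
have q0 k : 0 <= sqnorm_op (B k) (V k).
  by apply: le_trans (qV k); rewrite mulr_ge0 ?sqr_ge0 ?(ltW k10).
have dto0 : forall e, 0 < e -> exists K, forall k, (K <= k)%N -> d k <= e.
  apply: (@nonmonotone_descent _ (F \o X) d (F (X 0%N) - CF * (2 * s))
      (2^-1 * sigma * k1) (CF * C) m).
  - by rewrite !mulr_gt0// invr_gt0.
  - exact: mulr_ge0.
  - by move=> k; exact: frob_norm_ge0.
  - move=> k /=; have := FL _ _ (SX k) (SX 0%N).
    have := stiefel_dist_le (SX 0%N) (SX k); rewrite -/s => H.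
    have : CF * frob_norm (X 0%N - X k) <= CF * (2 * s) by rewrite ler_wpM2l.
    by lra.
  - move=> k /=; rewrite (manPQN_step XP).
    apply: (le_trans (manPQN_linesearch XP k)); rewrite lerD2l lerN2.
    rewrite dE exprMn -/(alpha k).
    have : alpha k * (k1 * frob_norm (V k) ^+ 2) <= alpha k * sqnorm_op (B k) (V k).
      by rewrite ler_wpM2l// ltW.
    have : alpha k ^+ 2 * (k1 * frob_norm (V k) ^+ 2) <=
        alpha k * (k1 * frob_norm (V k) ^+ 2).
      have a2 : alpha k ^+ 2 <= alpha k by rewrite expr2 ler_piMl// ltW.
      by rewrite ler_wpM2r// mulr_ge0 ?sqr_ge0 ?(ltW k10).
    have := alpha0 k; move: (alpha k) (frob_norm _) (sqnorm_op _ _) => a v q; nra.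
  - move=> k /=; rewrite (le_trans (FL _ _ (SX k) (SX k.+1)))// -mulrA ler_wpM2l//.
    by rewrite (manPQN_step XP) RtC//; exact: tangentZ.
(* With these eps and tau, each of the two error terms of
   [objective_retraction_decrease] is at most a quarter of k1 e t ||V||
   as long as t ||V|| <= tau. *)
pose eps := Num.min 1 (k1 * e / (4 * (K + Lh + 1))).
have KL1 : 0 < 4 * (K + Lh + 1) by rewrite mulr_gt0// ltr_wpDl// addr_ge0.
have eps0 : 0 < eps by rewrite lt_min ltr01 divr_gt0// mulr_gt0.
have eps1 : 0 <= eps <= 1 by rewrite (ltW eps0) ge_min lexx.
have epsK : (K + Lh) * eps <= k1 * e / 4.
  have : eps <= k1 * e / (4 * (K + Lh + 1)) by rewrite ge_min lexx orbT.
  by rewrite ler_pdivlMr//; lra.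
have [b b0 bP] := retraction_uniform RtP eps0.
pose tau := Num.min b (k1 * e / (16 * (L + 1))).
have L1 : 0 < 16 * (L + 1) by rewrite mulr_gt0// ltr_wpDl.
have tau0 : 0 < tau by rewrite lt_min b0 divr_gt0// mulr_gt0.
have taub : tau <= b by rewrite ge_min lexx.
have tauL : 4 * L * tau <= k1 * e / 4.
  have : tau <= k1 * e / (16 * (L + 1)) by rewrite ge_min lexx orbT.
  by rewrite ler_pdivlMr//; lra.
have [|K1 K1P] := dto0 (Num.min e (gamma * tau)); first by rewrite lt_min e0 mulr_gt0.
exists K1 => k /K1P; rewrite le_min dE => /andP[de dgt].
rewrite leNgt; apply/negP => eV.
case Nk : (N k) => [|i].
  by move: de; rewrite /alpha Nk expr0 mul1r leNgt eV.
pose t := gamma ^+ i; have t0 : 0 < t by rewrite exprn_gt0.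
have t1 : t <= 1 by rewrite exprn_ile1// ltW.
have w0 : 0 <= t * frob_norm (V k) by rewrite mulr_ge0 ?frob_norm_ge0// ltW.
have wtau : t * frob_norm (V k) <= tau.
  by move: dgt; rewrite /alpha Nk exprS -mulrA ler_pM2l.
have iN : (i < N k)%N by rewrite Nk.
apply: (manPQN_smallest XP iN); rewrite /linesearch_ok.
have tV : tangent (X k) (t *: V k) by exact: tangentZ.
have wn : frob_norm (t *: V k) = t * frob_norm (V k) by rewrite frob_normZ gtr0_norm.
have Rtt : frob_norm (Rt (X k) (t *: V k) - X k - t *: V k) <=
    eps * (t * frob_norm (V k)).
  by rewrite -wn; apply: bP => //; rewrite wn (le_trans wtau).
have t01 : 0 <= t <= 1 by rewrite (ltW t0).
have model := sub_argmin_decrease hc (manPQN_spd XP k) (TV k)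
  (manPQN_argmin XP (k := k)) (q0 k) t01.
have decr := objective_retraction_decrease fd gL hL (gK _ (SX k)) model (ltW t0) eps1 Rtt.
have Fmax : F (X k) <= \big[Num.max/F (X k)]_(k - m <= j < k.+1) F (X j).
  by apply: (@le_window_max _ (F \o X)); rewrite leq_subr leqnn.
rewrite -/t; apply: le_trans (lerD Fmax (lexx _)).
rewrite -lerBlDl; apply: le_trans decr _.
have tq : t * (k1 * frob_norm (V k) ^+ 2) <= t * sqnorm_op (B k) (V k).
  by rewrite ler_wpM2l// ltW.
set v := frob_norm (V k) in eV w0 wtau tq *; set q := sqnorm_op (B k) (V k) in tq *.
have H1 : (K + Lh) * eps * (t * v) <= k1 * e / 4 * (t * v) by rewrite ler_wpM2r.
have H2 : 4 * L * (t * v) ^+ 2 <= k1 * e / 4 * (t * v).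
  rewrite expr2 mulrA ler_wpM2r//; apply: le_trans tauL.
  by rewrite ler_wpM2l// mulr_ge0.
have H3 : k1 * e * (t * v) <= t * (k1 * v ^+ 2).
  rewrite (_ : t * (k1 * v ^+ 2) = k1 * v * (t * v)); last by ring.
  by rewrite ler_wpM2r// ler_pM2l// ltW.
have tq0 : 0 <= t * q by rewrite mulr_ge0 ?q0// ltW.
nra.
Qed.

(** * Accumulation points *)

(** For t in ]0, 1], the hypothesis at t U divided by t, together with convexity
    of h, bounds the conclusion from below by a multiple of - t. *)
Lemma variational_of_quadratic (R : realType) (n r : nat) (h : 'M[R]_(n, r) -> R)
    (X g : 'M[R]_(n, r)) (k2 : R) :
  convex_function setT h ->
  (forall U, tangent X U ->
     0 <= frob_dot g U + k2 * frob_norm U ^+ 2 + (h (X + U) - h X)) ->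
  forall U, tangent X U -> 0 <= frob_dot g U + (h (X + U) - h X).
Proof.
move=> /convex_functionP hc quad U TU; set A := _ + _.
have small t : 0 < t <= 1 -> 0 <= A + t * (k2 * frob_norm U ^+ 2).
  move=> /andP[t0 t1].
  have := quad _ (tangentZ t TU).
  rewrite frob_dotZr frob_normZ gtr0_norm// exprMn.
  have := hc (X + U) X t; rewrite (ltW t0) t1 => /(_ isT).
  have -> : t *: (X + U) + (1 - t) *: X = X + t *: U.
    by rewrite scalerDr addrAC -scalerDl [t + _]addrC subrK scale1r.
  move=> H1 H2; rewrite -(pmulr_rge0 _ t0) /A; nra.
set a := k2 * _ in small; rewrite leNgt; apply/negP => A0.
have a1 : 0 < a by have := small 1; rewrite ltr01 lexx => /(_ isT); lra.
(* This choice makes A + t a equal to A / 2, still negative. *)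
pose t := - A / (2 * a).
have ta : t * a = - A / 2 by rewrite /t; field; rewrite gt_eqF.
have t0 : 0 < t by rewrite divr_gt0 ?oppr_gt0// mulr_gt0.
have t1 : t <= 1.
  rewrite -(ler_pM2r a1) ta.
  by have := small 1; rewrite ltr01 lexx => /(_ isT); lra.
by have := small t; rewrite t0 t1 => /(_ isT); lra.
Qed.

(** A vector tangent at Xs need not be tangent at X_k, so it is projected; the
    function Phi collecting the terms of the comparison with V_k is continuous
    in the base point, at least - (K + Lh) ||V_k|| at X_k, and hence nonnegative at
    the cluster point. *)
Lemma manPQN_cluster_quadratic (R : realType) (n r : nat) (f h : 'M[R]_(n, r) -> R)
    (Rt : 'M[R]_(n, r) -> 'M[R]_(n, r) -> 'M[R]_(n, r))
    (L Lh gamma sigma k2 : R) (m : nat)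
    (B : nat -> 'M[R]_(n, r) -> 'M[R]_(n, r)) (X V : nat -> 'M[R]_(n, r))
    (N : nat -> nat) (Xs : 'M[R]_(n, r)) :
  frob_lipschitz L (gradient f) -> frob_lipschitz_fun Lh h -> retraction Rt ->
  manPQN f h Rt gamma sigma m B X V N ->
  (forall k W, tangent (X k) W ->
     0 <= sqnorm_op (B k) W <= k2 * frob_norm W ^+ 2) ->
  (forall e, 0 < e -> exists K, forall k, (K <= k)%N -> frob_norm (V k) <= e) ->
  cluster (X @ \oo) Xs -> stiefel R n r Xs /\
  forall U, tangent Xs U -> 0 <= frob_dot (gradient f Xs) U +
    k2 / 2 * frob_norm U ^+ 2 + (h (Xs + U) - h Xs).
Proof.
move=> gL hL RtP XP Bk V0 clXs; have SX := manPQN_stiefel RtP XP.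
have SXs : stiefel R n r Xs.
  apply: stiefel_closed => A AXs; apply: clXs => //.
  by exists 0%N => // k _; exact: SX.
split=> // U TU; have [Lh0 hLip] := hL.
have [K K0 gK] := stiefel_gradient_bounded gL (SX 0%N).
pose Phi Y := frob_dot (gradient f Y) (tangent_proj Y U) +
  k2 / 2 * frob_dot (tangent_proj Y U) (tangent_proj Y U) +
  (h (Y + tangent_proj Y U) - h Y).
have PhiXs : Phi Xs = frob_dot (gradient f Xs) U + k2 / 2 * frob_norm U ^+ 2 +
    (h (Xs + U) - h Xs).
  by rewrite /Phi (tangent_proj_id TU) sqr_frob_norm.
have PhiX k : - ((K + Lh) * frob_norm (V k)) <= Phi (X k).
  set W := tangent_proj (X k) U.
  have TW : tangent (X k) W by exact: tangent_proj_tangent.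
  have := manPQN_argmin XP TW; rewrite /sub_objective.
  have /andP[_] := Bk _ _ TW; rewrite sqr_frob_norm.
  have /andP[qV _] := Bk _ _ (manPQN_tangent XP k).
  have hV := hLip (X k) (X k + V k).
  rewrite opprD addNKr frob_normN in hV.
  have {}hV := le_trans (ler_norm _) hV.
  have := frob_cauchy_schwarz (gradient f (X k)) (V k).
  rewrite ler_norml => /andP[gV _].
  have gKV : frob_norm (gradient f (X k)) * frob_norm (V k) <= K * frob_norm (V k).
    by rewrite ler_wpM2r ?frob_norm_ge0// gK.
  rewrite /Phi -/W; lra.
have Phic : Phi @ nbhs Xs --> Phi Xs.
  have P0 : (fun Y => tangent_proj Y U) @ nbhs Xs --> tangent_proj Xs U.
    by apply: cvg_tangent_proj; exact: cvg_id.
  have hc := frob_lipschitz_fun_continuous hL.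
  apply: cvgD; [apply: cvgD|apply: cvgB].
  - by apply: cvg_frob_dot P0; exact: (frob_lipschitz_continuous gL).
  - by apply: cvgM; [exact: cvg_cst|exact: cvg_frob_dot].
  - apply: (@continuous_cvg _ _ _ _ _ (fun Y => Y + tangent_proj Y U) h); first exact: hc.
    by apply: cvgD P0; exact: cvg_id.
  - exact: hc.
rewrite -PhiXs leNgt; apply/negP => Phi0.
have e0 : 0 < - Phi Xs / 2 by rewrite divr_gt0// oppr_gt0.
have KL1 : 0 < K + Lh + 1 by rewrite ltr_wpDl// addr_ge0.
have [|k0 k0P] := V0 (- Phi Xs / 2 / (K + Lh + 1)); first by rewrite divr_gt0.
have A : nbhs Xs [set Y | Phi Y < Phi Xs / 2].
  move/cvgrPdist_lt : Phic => /(_ _ e0); apply: filterS => Y /=.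
  by rewrite ltr_norml => /andP[+ _]; lra.
have Xk : (X @ \oo) [set Y | exists2 k, (k0 <= k)%N & X k = Y].
  by exists k0 => // k k0k; exists k.
have [Y [[k k0k <-] /= Phik]] := clXs _ _ Xk A.
have := PhiX k; have := k0P _ k0k; rewrite ler_pdivlMr//.
by have := frob_norm_ge0 (V k); lra.
Qed.

Unset Implicit Arguments.

Theorem theorem4p1 (R : realType) (n r : nat)
    (f h : 'M[R]_(n, r) -> R)
    (Rt : 'M[R]_(n, r) -> 'M[R]_(n, r) -> 'M[R]_(n, r))
    (L Lh delta gamma sigma : R) (p m : nat)
    (B : nat -> 'M[R]_(n, r) -> 'M[R]_(n, r))
    (X V : nat -> 'M[R]_(n, r)) (N : nat -> nat)
    (f_diff : forall Y, differentiable f Y)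
    (gradf_lip : frob_lipschitz L (gradient f))
    (h_convex : convex_function setT h)
    (h_lip : frob_lipschitz_fun Lh h)
    (Rt_retraction : retraction Rt)
    (delta_gt0 : 0 < delta) (p_gt0 : (0 < p)%N)
    (gamma_gt0 : 0 < gamma) (gamma_lt1 : gamma < 1)
    (sigma_gt0 : 0 < sigma) (sigma_lt1 : sigma < 1)
    (m_gt0 : (0 < m)%N)
    (X_manPQN : manPQN f h Rt gamma sigma m B X V N)
    (B_bounds : forall k W, tangent (X k) W ->
      kappa1 L (varrho f) delta p * frob_norm W ^+ 2 <= sqnorm_op (B k) W /\
      sqnorm_op (B k) W <= kappa2 L (varrho f) delta p * frob_norm W ^+ 2) :
  forall Xs : 'M[R]_(n, r), cluster (X @ \oo) Xs -> stationary f h Xs.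

Proof.
have L0 : 0 <= L by have [] := gradf_lip.
have k10 : 0 < kappa1 L (varrho f) delta p by exact: kappa1_gt0 (varrho_ge0 f) _.
have lower k W : tangent (X k) W ->
    kappa1 L (varrho f) delta p * frob_norm W ^+ 2 <= sqnorm_op (B k) W.
  by move=> /B_bounds[].
have both k W : tangent (X k) W ->
    0 <= sqnorm_op (B k) W <= kappa2 L (varrho f) delta p * frob_norm W ^+ 2.
  move=> /B_bounds[lo ->]; rewrite andbT; apply: le_trans lo.
  by rewrite mulr_ge0 ?sqr_ge0// ltW.
have steps := manPQN_steps_vanish f_diff gradf_lip h_convex h_lip Rt_retraction
  gamma_gt0 gamma_lt1 sigma_gt0 sigma_lt1 X_manPQN k10 lower.
move=> Xs /(manPQN_cluster_quadratic gradf_lip h_lip Rt_retraction X_manPQN both steps).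
move=> [SXs quad]; split=> //.
have vari := variational_of_quadratic h_convex quad.
have [W dW PW] := normal_subgradient h_convex SXs vari.
exists (tangent_proj Xs W); first by exists W.
by rewrite /riem_gradient -tangent_projD.
Qed.
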